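(* Let $f,g:\mathbb R^N\to\mathbb R\cup\{+\infty\}$ be proper lsc convex with $\mathrm{ri}(\mathrm{dom}f)\cap\mathrm{ri}(\mathrm{dom}g)\neq\emptyset$ and $\mathrm{Argmin}(f+g)\neq\emptyset$. Let $\gamma>0$, $\tau_k\in]0,2[$ with $\sum_k\tau_k(2-\tau_k)=+\infty$, and consider the Douglas–Rachford iteration $v_{k+1}=\mathrm{prox}_{\gamma f}(2x_k-z_k)$, $z_{k+1}=z_k+\tau_k(v_{k+1}-x_k)$, $x_{k+1}=\mathrm{prox}_{\gamma g}(z_{k+1})$ (with $x_0=\mathrm{prox}_{\gamma g}(z_0)$). Then $z_k\to z^\star$, where $x^\star=\mathrm{prox}_{\gamma g}(z^\star)\in\mathrm{Argmin}(f+g)$, and $x_k\to x^\star$, $v_k\to x^\star$. Let $u^\star=(z^\star-x^\star)/\gamma$. (i) If $g$ is mirror-stratifiable with respect to $(\mathcal S^g,\mathcal S^{g^*})$, then for $k$ large enough $M^g_{x^\star}\le M^g_{x_k}\le J_{g^*}(M^{g^*}_{u^\star})$. (ii) If $f$ is mirror-stratifiable with respect to $(\mathcal S^f,\mathcal S^{f^*})$, then for $k$ large enough $M^f_{x^\star}\le M^f_{v_k}\le J_{f^*}(M^{f^*}_{-u^\star})$.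
   Context: $\mathrm{prox}_{\gamma h}(x)=\mathrm{argmin}_z\frac12\|z-x\|^2+\gamma h(z)$; $\mathrm{ri}$ = relative interior. A stratification of a set $D$ is a finite partition $\mathcal S$ of $D$ into nonempty sets called strata such that for any strata $M,M'$, $M\cap\mathrm{cl}(M')\neq\emptyset$ implies $M\subset\mathrm{cl}(M')$; ordered by $M\le M'$ iff $M\subset\mathrm{cl}(M')$. $M^h_x$ denotes the stratum of $\mathcal S^h$ containing $x$ (similarly for dual strata). For proper lsc convex $R$ with conjugate $R^*$, $J_R(S)=\bigcup_{x\in S}\mathrm{ri}(\partial R(x))$, $J_{R^*}$ analogously. $R$ is mirror-stratifiable with respect to a stratification $\mathcal S$ of $\mathrm{dom}(\partial R)$ and a stratification $\mathcal S^*$ of $\mathrm{dom}(\partial R^* )$ if (i) $J_R$ maps $\mathcal S$ bijectively onto $\mathcal S^*$ with inverse $J_{R^*}$, i.e. for all $M\in\mathcal S$, $M^*\in\mathcal S^*$: $M^*=J_R(M)\iff J_{R^*}(M^* )=M$; and (ii) for all $M,M'\in\mathcal S$: $M\le M'\iff J_R(M)\ge J_R(M')$. *)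

(* Defs.v *)
From Stdlib Require Import Reals Lra List ClassicalEpsilon.
Require Stdlib.Vectors.Fin.
Open Scope R_scope.

Definition vec (N : nat) : Type := Fin.t N -> R.

Fixpoint fsum (n : nat) : (Fin.t n -> R) -> R :=
  match n with
  | O => fun _ => 0
  | S m => fun f => f (@Fin.F1 m) + fsum m (fun i => f (Fin.FS i))
  end.

Definition vzero {N} : vec N := fun _ => 0.
Definition vadd {N} (a b : vec N) : vec N := fun i => a i + b i.
Definition vopp {N} (a : vec N) : vec N := fun i => - a i.
Definition vsub {N} (a b : vec N) : vec N := fun i => a i - b i.
Definition vscal {N} (c : R) (a : vec N) : vec N := fun i => c * a i.
Definition inner {N} (a b : vec N) : R := fsum N (fun i => a i * b i).
Definition norm {N} (a : vec N) : R := sqrt (inner a a).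

Definition conv {N} (s : nat -> vec N) (l : vec N) : Prop :=
  forall e, 0 < e -> exists K, forall k, (K <= k)%nat -> norm (vsub (s k) l) < e.

Definition set (N : nat) := vec N -> Prop.
Definition subset {N} (A B : set N) : Prop := forall x, A x -> B x.
Definition set_eq {N} (A B : set N) : Prop := forall x, A x <-> B x.
Definition cl {N} (A : set N) : set N :=
  fun x => forall e, 0 < e -> exists y, A y /\ norm (vsub y x) < e.
Definition aff {N} (A : set N) : set N :=
  fun y => exists l : list (R * vec N),
    Forall (fun p => A (snd p)) l /\
    fold_right (fun p s => fst p + s) 0 l = 1 /\
    y = fold_right (fun p acc => vadd (vscal (fst p) (snd p)) acc) vzero l.
Definition ri {N} (A : set N) : set N :=
  fun x => A x /\ exists e, 0 < e /\
    forall y, aff A y -> norm (vsub y x) < e -> A y.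

(* ---------- extended reals R ∪ {+oo} : None = +oo ---------- *)
Definition ext := option R.
Definition ele (a b : ext) : Prop :=
  match b with
  | None => True
  | Some b' => match a with None => False | Some a' => a' <= b' end
  end.
Definition eadd (a b : ext) : ext :=
  match a, b with Some a', Some b' => Some (a' + b') | _, _ => None end.
Definition escal (c : R) (a : ext) : ext :=
  match a with Some a' => Some (c * a') | None => None end.
Definition rlt (c : R) (a : ext) : Prop :=
  match a with None => True | Some a' => c < a' end.

Definition dom {N} (f : vec N -> ext) : set N := fun x => f x <> None.
Definition proper {N} (f : vec N -> ext) : Prop := exists x, f x <> None.
Definition convex {N} (f : vec N -> ext) : Prop :=
  forall x y fx fy t, 0 < t < 1 -> f x = Some fx -> f y = Some fy ->
    ele (f (vadd (vscal t x) (vscal (1 - t) y))) (Some (t * fx + (1 - t) * fy)).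
Definition lsc {N} (f : vec N -> ext) : Prop :=
  forall x c, rlt c (f x) ->
    exists d, 0 < d /\ forall y, norm (vsub y x) < d -> rlt c (f y).

Definition subdiff {N} (f : vec N -> ext) (x : vec N) : set N :=
  fun u => exists fx, f x = Some fx /\
    forall y, ele (Some (fx + inner u (vsub y x))) (f y).

Definition is_conj {N} (f : vec N -> ext) (u : vec N) (c : ext) : Prop :=
  match c with
  | Some a => is_lub (fun r => exists x fx, f x = Some fx /\ r = inner u x - fx) a
  | None => forall M, exists x fx, f x = Some fx /\ M < inner u x - fx
  end.
Definition conjf {N} (f : vec N -> ext) : vec N -> ext :=
  fun u => epsilon (inhabits None) (is_conj f u).

Definition is_prox {N} (gamma : R) (h : vec N -> ext) (x p : vec N) : Prop :=
  h p <> None /\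
  forall z, ele (eadd (Some (/2 * (norm (vsub p x))^2)) (escal gamma (h p)))
                (eadd (Some (/2 * (norm (vsub z x))^2)) (escal gamma (h z))).

Definition argmin_sum {N} (f g : vec N -> ext) (x : vec N) : Prop :=
  exists a, eadd (f x) (g x) = Some a /\ forall y, ele (Some a) (eadd (f y) (g y)).

Definition stratification {N} (D : set N) (S : list (set N)) : Prop :=
  (forall M, In M S -> exists x, M x) /\
  (forall i j Mi Mj, nth_error S i = Some Mi -> nth_error S j = Some Mj ->
      i <> j -> forall x, Mi x -> Mj x -> False) /\
  (forall x, D x <-> exists M, In M S /\ M x) /\
  (forall M M', In M S -> In M' S -> (exists x, M x /\ cl M' x) -> subset M (cl M')).

Definition strat_le {N} (M M' : set N) : Prop := subset M (cl M').

Definition stratum {N} (S : list (set N)) (x : vec N) (M : set N) : Prop :=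
  In M S /\ M x.

Definition J {N} (Rf : vec N -> ext) (A : set N) : set N :=
  fun u => exists x, A x /\ ri (subdiff Rf x) u.

Definition mirror_strat {N} (Rf : vec N -> ext) (S Ss : list (set N)) : Prop :=
  stratification (fun x => exists u, subdiff Rf x u) S /\
  stratification (fun u => exists x, subdiff (conjf Rf) u x) Ss /\
  (forall M, In M S -> exists Ms, In Ms Ss /\ set_eq Ms (J Rf M)) /\
  (forall Ms, In Ms Ss -> exists M, In M S /\ set_eq M (J (conjf Rf) Ms)) /\
  (forall M Ms, In M S -> In Ms Ss ->
      (set_eq Ms (J Rf M) <-> set_eq (J (conjf Rf) Ms) M)) /\
  (forall M M', In M S -> In M' S ->
      (strat_le M M' <-> strat_le (J Rf M') (J Rf M))).

(* Main.v *)
(** A minimiser of f + g splits as 0 = (-u) + u with u a subgradient of g and -u one of f,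
    by a finite-dimensional Hahn-Banach argument under the relative interior condition; this
    gives a fixed point of the Douglas-Rachford operator.  The iterates are Fejer monotone with
    respect to fixed points and the residuals v_{k+1} - x_k have nonincreasing norm, so
    divergence of sum tau_k (2 - tau_k) drives the residuals to 0; cluster points are then
    fixed points by closedness of subdifferential graphs, whence convergence.

    For the strata, a convergent sequence eventually visits only strata whose closure contains
    the limit.  On the primal side this gives the lower bound.  On the dual side, the
    subgradients u_k at x_k lie in the closure of ri (subdiff g x_k), hence in that of
    J_g (M_{x_k}), so M*_{u*} <= J_g (M_{x_k}) eventually, and the order-reversing bijection
    turns this into the upper bound. *)
Require Import Defs.
From Stdlib Require Import Reals Lra Lia List Classical FunctionalExtensionality ClassicalEpsilon.
Require Stdlib.Vectors.Fin.
Open Scope R_scope.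

(** * Inner product and norm on coordinate vectors *)

Lemma fsum_ext n (a b : Fin.t n -> R) : (forall i, a i = b i) -> fsum n a = fsum n b.
Proof. intros H. f_equal. now extensionality i. Qed.

Lemma fsum_plus n (a b : Fin.t n -> R) :
  fsum n (fun i => a i + b i) = fsum n a + fsum n b.
Proof. induction n as [|n IH]; simpl; [lra|]. rewrite IH. lra. Qed.

Lemma fsum_scal n c (a : Fin.t n -> R) : fsum n (fun i => c * a i) = c * fsum n a.
Proof. induction n as [|n IH]; simpl; [lra|]. rewrite IH. lra. Qed.

Lemma inner_comm N (a b : vec N) : inner a b = inner b a.
Proof. apply fsum_ext; intros; ring. Qed.

Lemma inner_add_l N (a b c : vec N) : inner (vadd a b) c = inner a c + inner b c.
Proof. unfold inner; rewrite <- fsum_plus. apply fsum_ext; intros; unfold vadd; ring. Qed.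

Lemma inner_scal_l N t (a c : vec N) : inner (vscal t a) c = t * inner a c.
Proof. unfold inner; rewrite <- fsum_scal. apply fsum_ext; intros; unfold vscal; ring. Qed.

Lemma vsub_eq N (a b : vec N) : vsub a b = vadd a (vscal (-1) b).
Proof. extensionality i. unfold vsub, vadd, vscal. ring. Qed.

Lemma vopp_eq N (a : vec N) : vopp a = vscal (-1) a.
Proof. extensionality i. unfold vopp, vscal. ring. Qed.

Lemma inner_sub_l N (a b c : vec N) : inner (vsub a b) c = inner a c - inner b c.
Proof. rewrite vsub_eq, inner_add_l, inner_scal_l. ring. Qed.

Lemma inner_opp_l N (a c : vec N) : inner (vopp a) c = - inner a c.
Proof. rewrite vopp_eq, inner_scal_l. ring. Qed.

Lemma inner_zero_l N (c : vec N) : inner vzero c = 0.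
Proof.
  replace (@vzero N) with (vscal 0 c) by (extensionality i; unfold vscal, vzero; ring).
  rewrite inner_scal_l. ring.
Qed.

Lemma inner_add_r N (a b c : vec N) : inner c (vadd a b) = inner c a + inner c b.
Proof. now rewrite !(inner_comm _ c), inner_add_l. Qed.

Lemma inner_scal_r N t (a c : vec N) : inner c (vscal t a) = t * inner c a.
Proof. now rewrite !(inner_comm _ c), inner_scal_l. Qed.

Lemma inner_sub_r N (a b c : vec N) : inner c (vsub a b) = inner c a - inner c b.
Proof. now rewrite !(inner_comm _ c), inner_sub_l. Qed.

Lemma inner_opp_r N (a c : vec N) : inner c (vopp a) = - inner c a.
Proof. now rewrite !(inner_comm _ c), inner_opp_l. Qed.

Lemma inner_zero_r N (c : vec N) : inner c vzero = 0.
Proof. now rewrite inner_comm, inner_zero_l. Qed.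

Ltac inner_expand :=
  repeat first
    [ rewrite inner_add_l | rewrite inner_sub_l | rewrite inner_scal_l
    | rewrite inner_opp_l | rewrite inner_zero_l
    | rewrite inner_add_r | rewrite inner_sub_r | rewrite inner_scal_r
    | rewrite inner_opp_r | rewrite inner_zero_r ].

Ltac inner_expand_in H :=
  repeat first
    [ rewrite inner_add_l in H | rewrite inner_sub_l in H | rewrite inner_scal_l in H
    | rewrite inner_opp_l in H | rewrite inner_zero_l in H
    | rewrite inner_add_r in H | rewrite inner_sub_r in H | rewrite inner_scal_r in H
    | rewrite inner_opp_r in H | rewrite inner_zero_r in H ].

Ltac vec_ring :=
  let i := fresh "i" in
  extensionality i; unfold vsub, vadd, vscal, vopp, vzero; ring.

Lemma inner_self_ge0 N (a : vec N) : 0 <= inner a a.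
Proof. induction N as [|N IH]; [apply Rle_refl|]. specialize (IH (fun i => a (Fin.FS i))).
  unfold inner in *; simpl. nra. Qed.

Lemma coord_sqr_le N (a : vec N) i : a i * a i <= inner a a.
Proof.
  induction i as [n|n i IH].
  - pose proof (inner_self_ge0 _ (fun j => a (Fin.FS j))). unfold inner in *; simpl. lra.
  - specialize (IH (fun j => a (Fin.FS j))). unfold inner in *; simpl in *. nra.
Qed.

Lemma norm_ge0 N (a : vec N) : 0 <= norm a.
Proof. apply sqrt_pos. Qed.

Lemma norm_sqr N (a : vec N) : norm a * norm a = inner a a.
Proof. apply sqrt_sqrt, inner_self_ge0. Qed.

Lemma norm_le N (a : vec N) c : 0 <= c -> inner a a <= c * c -> norm a <= c.
Proof. intros Hc H. rewrite <- norm_sqr in H. pose proof (norm_ge0 _ a). nra. Qed.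

Lemma norm_lt N (a : vec N) c : 0 <= c -> inner a a < c * c -> norm a < c.
Proof. intros Hc H. rewrite <- norm_sqr in H. pose proof (norm_ge0 _ a). nra. Qed.

Lemma coord_le_norm N (a : vec N) i : Rabs (a i) <= norm a.
Proof.
  pose proof (coord_sqr_le _ a i) as H. rewrite <- norm_sqr in H.
  pose proof (norm_ge0 _ a). apply Rabs_le. split; nra.
Qed.

Lemma cauchy_schwarz N (a b : vec N) : Rabs (inner a b) <= norm a * norm b.
Proof.
  assert (H : inner a b * inner a b <= inner a a * inner b b).
  { destruct (Req_dec (inner b b) 0) as [Hb|Hb].
    - assert (Hz : b = vzero).
      { extensionality i. pose proof (coord_sqr_le _ b i). unfold vzero. nra. }
      rewrite Hz, !inner_zero_r. lra.
    - pose proof (inner_self_ge0 _ b).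
      (* The squared norm of $\langle b,b\rangle a-\langle a,b\rangle b$ equals $\langle b,b\rangle$
         times the defect in the inequality. *)
      pose proof (inner_self_ge0 _ (vsub (vscal (inner b b) a) (vscal (inner a b) b))) as H1.
      inner_expand_in H1. rewrite (inner_comm _ b a) in H1.
      assert (0 <= inner b b * (inner a a * inner b b - inner a b * inner a b)) by lra.
      nra. }
  pose proof (norm_ge0 _ a). pose proof (norm_ge0 _ b).
  assert (0 <= norm a * norm b) by nra.
  rewrite <- !norm_sqr in H. apply Rabs_le. split; nra.
Qed.

Lemma norm_triangle N (a b : vec N) : norm (vadd a b) <= norm a + norm b.
Proof.
  pose proof (norm_ge0 _ a). pose proof (norm_ge0 _ b). apply norm_le; [lra|].
  inner_expand. rewrite (inner_comm _ b a).
  pose proof (cauchy_schwarz _ a b). pose proof (Rle_abs (inner a b)).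
  pose proof (norm_sqr _ a). pose proof (norm_sqr _ b). nra.
Qed.

Lemma norm_scal N t (a : vec N) : norm (vscal t a) = Rabs t * norm a.
Proof.
  unfold norm. inner_expand. rewrite <- sqrt_Rsqr_abs, <- sqrt_mult_alt by apply Rle_0_sqr.
  f_equal. unfold Rsqr. ring.
Qed.

Lemma norm_triangle_sub N (a b c : vec N) :
  norm (vsub a c) <= norm (vsub a b) + norm (vsub b c).
Proof.
  replace (vsub a c) with (vadd (vsub a b) (vsub b c)) by vec_ring. apply norm_triangle.
Qed.

(** * Convergence of vector sequences *)

Lemma fsum_cv n (s : nat -> Fin.t n -> R) (l : Fin.t n -> R) :
  (forall i, Un_cv (fun k => s k i) (l i)) -> Un_cv (fun k => fsum n (s k)) (fsum n l).
Proof.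
  revert s l. induction n as [|n IH]; intros s l H; simpl.
  - intros e He. exists O. intros. rewrite Rdist_eq. lra.
  - apply CV_plus; [apply H|]. apply (IH (fun k i => s k (Fin.FS i))). intros; apply H.
Qed.

Lemma Un_cv_const c : Un_cv (fun _ => c) c.
Proof. intros e He. exists O. intros. rewrite Rdist_eq. lra. Qed.

(** A coordinate is bounded by the norm, and the squared norm is a finite sum of squares. This
    transfers the limit laws of real sequences to vectors. *)
Lemma conv_coord N (s : nat -> vec N) l :
  conv s l <-> forall i, Un_cv (fun k => s k i) (l i).
Proof.
  split.
  - intros H i e He. destruct (H e He) as [K HK]. exists K. intros k Hk.
    eapply Rle_lt_trans; [|apply (HK k Hk)]. apply (coord_le_norm _ (vsub (s k) l) i).
  - intros H e He.
    assert (H2 : Un_cv (fun k => inner (vsub (s k) l) (vsub (s k) l)) 0).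
    { replace 0 with (fsum N (fun i => (l i - l i) * (l i - l i))).
      - apply (fsum_cv N (fun k i => (s k i - l i) * (s k i - l i))). intros i.
        apply CV_mult; apply CV_minus; auto using Un_cv_const.
      - rewrite <- (inner_zero_l N vzero). apply fsum_ext; intros; unfold vzero; ring. }
    destruct (H2 (e * e)) as [K HK]; [nra|]. exists K. intros k Hk.
    apply norm_lt; [lra|]. specialize (HK k Hk). unfold Rdist in HK.
    apply Rabs_def2 in HK. lra.
Qed.

Lemma inner_cv N (a b : nat -> vec N) la lb :
  conv a la -> conv b lb -> Un_cv (fun k => inner (a k) (b k)) (inner la lb).
Proof.
  rewrite !conv_coord. intros Ha Hb. apply (fsum_cv N (fun k i => a k i * b k i)).
  intros i. now apply CV_mult.
Qed.

Lemma conv_add N (a b : nat -> vec N) la lb :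
  conv a la -> conv b lb -> conv (fun k => vadd (a k) (b k)) (vadd la lb).
Proof. rewrite !conv_coord. intros Ha Hb i. now apply CV_plus. Qed.

Lemma conv_sub N (a b : nat -> vec N) la lb :
  conv a la -> conv b lb -> conv (fun k => vsub (a k) (b k)) (vsub la lb).
Proof. rewrite !conv_coord. intros Ha Hb i. now apply CV_minus. Qed.

Lemma conv_const N (a : vec N) : conv (fun _ => a) a.
Proof. rewrite conv_coord. intros i. apply Un_cv_const. Qed.

Lemma conv_scal N c (a : nat -> vec N) la :
  conv a la -> conv (fun k => vscal c (a k)) (vscal c la).
Proof. rewrite !conv_coord. intros Ha i. apply CV_mult; auto using Un_cv_const. Qed.

(** Extractions are only asked to satisfy [n <= phi n]: this preserves limits and is stable under
    composition. *)
Lemma conv_subseq N (s : nat -> vec N) l (phi : nat -> nat) :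
  (forall n, (n <= phi n)%nat) -> conv s l -> conv (fun n => s (phi n)) l.
Proof.
  intros Hp H e He. destruct (H e He) as [K HK]. exists K. intros k Hk. apply HK.
  specialize (Hp k). lia.
Qed.

(** Meant for [v], whose term at index 0 is not produced by the iteration. *)
Lemma conv_unshift N (s : nat -> vec N) l : conv (fun k => s (S k)) l -> conv s l.
Proof.
  intros H e He. destruct (H e He) as [K HK]. exists (S K). intros [|k] Hk; [lia|].
  apply HK. lia.
Qed.

(** * Compactness of bounded sequences *)

Lemma real_subseq (s : nat -> R) B : (forall n, Rabs (s n) <= B) ->
  exists l phi, (forall n, (n <= phi n)%nat) /\ Un_cv (fun n => s (phi n)) l.
Proof.
  intros H.
  destruct (Bolzano_Weierstrass s (fun c => -B <= c <= B)) as [l Hl].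
  - apply compact_P3.
  - intros n. specialize (H n). pose proof (Rle_abs (s n)).
    pose proof (Rle_abs (- s n)) as H'. rewrite Rabs_Ropp in H'. lra.
  (* A cluster value [l] has, for every [n], a term of index at least [n] within [/ (INR n + 1)];
     choosing one for each [n] gives the extraction. *)
  - assert (Hc : forall n, exists p, (n <= p)%nat /\ Rabs (s p - l) < / (INR n + 1)).
    { intros n. assert (0 < / (INR n + 1)) by (apply Rinv_0_lt_compat; pose proof (pos_INR n); lra).
      destruct (Hl (disc l (mkposreal _ H0)) n) as [p [Hp1 Hp2]].
      - exists (mkposreal _ H0). intros y Hy; exact Hy.
      - exists p. split; auto. }
    apply choice in Hc. destruct Hc as [phi Hphi].
    exists l, phi. split; [apply Hphi|]. intros e He.
    destruct (archimed_cor1 e He) as [K [HK HK0]]. exists K. intros n Hn.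
    eapply Rlt_trans; [apply Hphi|]. eapply Rlt_trans; [|apply HK].
    apply Rinv_lt_contravar.
    + pose proof (pos_INR n). apply lt_0_INR in HK0. nra.
    + apply le_INR in Hn. lra.
Qed.

Definition vtail {n} (a : vec (S n)) : vec n := fun i => a (Fin.FS i).
Definition vcons {n} (c : R) (a : vec n) : vec (S n) :=
  fun i => Fin.caseS' i (fun _ => R) c a.

Lemma vec_S_ext n (a b : vec (S n)) : a Fin.F1 = b Fin.F1 -> vtail a = vtail b -> a = b.
Proof.
  intros H1 H2. extensionality i. apply (Fin.caseS' i); [exact H1|].
  intros j. exact (equal_f H2 j).
Qed.

Lemma inner_S n (a b : vec (S n)) :
  inner a b = a Fin.F1 * b Fin.F1 + inner (vtail a) (vtail b).
Proof. reflexivity. Qed.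

(** Induction on the dimension: extract for the first coordinate, then for the tails along that
    extraction. *)
Lemma vec_subseq N (s : nat -> vec N) B : (forall n, norm (s n) <= B) ->
  exists l phi, (forall n, (n <= phi n)%nat) /\ conv (fun n => s (phi n)) l.
Proof.
  intros H.
  assert (Hc : forall i n, Rabs (s n i) <= B)
    by (intros; eapply Rle_trans; [apply coord_le_norm|apply H]).
  clear H. revert s Hc. induction N as [|N IH]; intros s Hc.
  - exists vzero, (fun n => n). split; [auto|]. rewrite conv_coord. intros i. inversion i.
  - destruct (real_subseq (fun n => s n Fin.F1) B) as [l1 [phi1 [Hp1 Hl1]]]; [auto|].
    destruct (IH (fun n => vtail (s (phi1 n)))) as [l2 [phi2 [Hp2 Hl2]]].
    { intros; apply Hc. }
    exists (vcons l1 l2), (fun n => phi1 (phi2 n)). split.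
    { intros n. specialize (Hp1 (phi2 n)). specialize (Hp2 n). lia. }
    rewrite conv_coord in *. intros i. apply (Fin.caseS' i).
    + simpl. intros e He. destruct (Hl1 e He) as [K HK]. exists K. intros n Hn.
      apply HK. specialize (Hp2 n). lia.
    + intros j. apply Hl2.
Qed.

(** * Subdifferentials and proximal points *)

Lemma subdiff_monotone N (f : vec N -> ext) x y u w :
  subdiff f x u -> subdiff f y w -> 0 <= inner (vsub u w) (vsub x y).
Proof.
  intros [fx [Hx H1]] [fy [Hy H2]]. specialize (H1 y). specialize (H2 x).
  rewrite Hy in H1. rewrite Hx in H2. simpl in *.
  inner_expand_in H1. inner_expand_in H2. inner_expand. lra.
Qed.

Lemma subdiff_convex N (f : vec N -> ext) x a b t : 0 <= t <= 1 ->
  subdiff f x a -> subdiff f x b -> subdiff f x (vadd (vscal t a) (vscal (1 - t) b)).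
Proof.
  intros Ht [fx [Hx H1]] [fx' [Hx' H2]]. exists fx. split; [auto|]. intros y.
  specialize (H1 y). specialize (H2 y). rewrite Hx in Hx'. injection Hx' as <-.
  destruct (f y) as [fy|]; simpl in *; [|auto].
  rewrite inner_add_l, !inner_scal_l. nra.
Qed.

(** Since [f x] may a priori be infinite, the argument uses finite thresholds [c] below [f x]: by
    lower semicontinuity [f (xk k)] eventually exceeds [c], and the subgradient inequality at [y]
    passes to the limit. *)
Lemma subdiff_closed N (f : vec N -> ext) (xk uk : nat -> vec N) x u :
  lsc f -> conv xk x -> conv uk u -> (forall k, subdiff f (xk k) (uk k)) ->
  subdiff f x u.
Proof.
  intros Hlsc Hx Hu Hs.
  assert (Hkey : forall c y fy, rlt c (f x) -> f y = Some fy -> c <= fy - inner u (vsub y x)).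
  { intros c y fy Hc Hy. destruct (Hlsc x c Hc) as [d [Hd Hlow]].
    apply Rnot_lt_le. intros Hlt.
    assert (Hcv : Un_cv (fun k => inner (uk k) (vsub y (xk k))) (inner u (vsub y x)))
      by (apply inner_cv; [auto|]; apply conv_sub; auto using conv_const).
    destruct (Hcv (c - (fy - inner u (vsub y x)))) as [K1 HK1]; [lra|].
    destruct (Hx d Hd) as [K2 HK2].
    specialize (HK1 (max K1 K2) ltac:(lia)). specialize (HK2 (max K1 K2) ltac:(lia)).
    apply Hlow in HK2. destruct (Hs (max K1 K2)) as [a [Ha Hsub]].
    rewrite Ha in HK2. specialize (Hsub y). rewrite Hy in Hsub. simpl in *.
    unfold Rdist in HK1. apply Rabs_def2 in HK1. lra. }
  destruct (Hs O) as [b [Hb _]].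
  destruct (f x) as [a|] eqn:Hfx.
  - exists a. split; [auto|]. intros y. destruct (f y) as [fy|] eqn:Hy; simpl; [|auto].
    apply Rnot_lt_le. intros Hlt.
    set (e := a + inner u (vsub y x) - fy) in *.
    specialize (Hkey (a - e / 2) y fy). simpl in Hkey. unfold e in *.
    assert (a - (a + inner u (vsub y x) - fy) / 2 <= fy - inner u (vsub y x))
      by (apply Hkey; [lra|auto]). lra.
  (* If [f x] were infinite every threshold would be admissible; testing at [xk O], where [f] is
     finite, with a threshold one unit too high is contradictory. *)
  - pose proof (Hkey (b - inner u (vsub (xk O) x) + 1) (xk O) b I Hb). lra.
Qed.

(** Compare [p] with $p+t(y-p)$, use convexity and divide by $t$; the remaining quadratic term
    $tB/2$ vanishes with $t$. *)
Lemma prox_subdiff N gamma (h : vec N -> ext) z p : convex h -> 0 < gamma ->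
  is_prox gamma h z p -> subdiff h p (vscal (/ gamma) (vsub z p)).
Proof.
  intros Hc Hg [Hd Hmin]. destruct (h p) as [hp|] eqn:Hp; [clear Hd|congruence].
  exists hp. split; [auto|]. intros y. destruct (h y) as [hy|] eqn:Hy; simpl; [|auto].
  set (A := inner (vsub p z) (vsub y p)). set (B := inner (vsub y p) (vsub y p)).
  assert (Hineq : forall t, 0 < t < 1 -> 0 <= A + / 2 * t * B + gamma * (hy - hp)).
  { intros t Ht. pose proof (Hc y p hy hp t Ht Hy Hp) as Hw.
    specialize (Hmin (vadd (vscal t y) (vscal (1 - t) p))).
    destruct (h (vadd (vscal t y) (vscal (1 - t) p))) as [hw|]; simpl in *; [|contradiction].
    rewrite !Rmult_1_r, !norm_sqr in Hmin.
    replace (vsub (vadd (vscal t y) (vscal (1 - t) p)) z)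
      with (vadd (vsub p z) (vscal t (vsub y p))) in Hmin by vec_ring.
    rewrite inner_add_l, !inner_add_r, !inner_scal_l, !inner_scal_r in Hmin.
    rewrite (inner_comm _ (vsub y p) (vsub p z)) in Hmin. fold A B in Hmin.
    assert (gamma * hw <= gamma * (t * hy + (1 - t) * hp)) by nra.
    apply (Rmult_le_reg_l t); nra. }
  assert (0 <= A + gamma * (hy - hp)).
  { apply Rnot_lt_le. intros Hlt. assert (HB : 0 <= B) by apply inner_self_ge0.
    (* If the limit inequality fails by [e], then $t=1/(2+B/e)$ is below 1 and satisfies $tB\le e$,
       so the quadratic term recovers at most half of the failure. *)
    set (e := - (A + gamma * (hy - hp))) in *.
    assert (HBe : 0 <= B / e) by (apply Rle_mult_inv_pos; unfold e; lra).
    assert (Ht : 0 < / (2 + B / e)) by (apply Rinv_0_lt_compat; lra).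
    assert (Ht1 : / (2 + B / e) < 1) by (rewrite <- Rinv_1; apply Rinv_lt_contravar; lra).
    specialize (Hineq _ (conj Ht Ht1)).
    assert (HtB : / (2 + B / e) * B <= e).
    { apply (Rmult_le_reg_l (2 + B / e)); [lra|].
      rewrite <- Rmult_assoc, Rinv_r, Rmult_1_l by lra.
      assert (e * (B / e) = B) by (field; unfold e; lra).
      assert (0 < e) by (unfold e; lra). nra. }
    assert (Hl : / 2 * / (2 + B / e) * B <= e / 2) by lra.
    unfold e in *. lra. }
  rewrite inner_scal_l.
  replace (inner (vsub z p) (vsub y p)) with (- A) by (unfold A; inner_expand; ring).
  apply (Rmult_le_reg_l gamma); [auto|]. rewrite Rmult_plus_distr_l.
  rewrite <- Rmult_assoc, Rinv_r by lra. lra.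
Qed.

(** Here $\frac12\|y-z\|^2-\frac12\|p-z\|^2=\frac12\|y-p\|^2-\langle z-p,y-p\rangle$, and the first
    square on the right is nonnegative. *)
Lemma subdiff_prox N gamma (h : vec N -> ext) z p : 0 < gamma ->
  subdiff h p (vscal (/ gamma) (vsub z p)) -> is_prox gamma h z p.
Proof.
  intros Hg [hp [Hp H]]. split; [congruence|]. intros y. specialize (H y). rewrite Hp.
  destruct (h y) as [hy|]; simpl in *; [|auto].
  rewrite !Rmult_1_r, !norm_sqr.
  assert (H' : gamma * hp + inner (vsub z p) (vsub y p) <= gamma * hy).
  { apply (Rmult_le_compat_l gamma) in H; [|lra].
    rewrite inner_scal_l, Rmult_plus_distr_l, <- Rmult_assoc, Rinv_r in H; lra. }
  pose proof (inner_self_ge0 _ (vsub y p)) as H0.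
  replace (vsub y z) with (vsub (vsub y p) (vsub z p)) by vec_ring.
  replace (vsub p z) with (vopp (vsub z p)) by vec_ring.
  set (a := vsub y p) in *. set (b := vsub z p) in *.
  inner_expand. rewrite (inner_comm _ a b). lra.
Qed.

(** * Splitting a minimiser of a sum *)

(* Finite-dimensional Hahn-Banach, one coordinate at a time: the value on the
   first coordinate is squeezed between the constraints coming from both signs. *)
Lemma linear_minorant n (K : vec n -> R -> Prop) :
  (forall w a w' a', K w a -> K w' a' -> K (vadd w w') (a + a')) ->
  (forall t w a, 0 < t -> K w a -> K (vscal t w) (t * a)) ->
  (forall w a, K w a -> exists b, K (vopp w) b) ->
  (forall a, K vzero a -> 0 <= a) ->
  exists u, forall w a, K w a -> inner u w <= a.
Proof.
  revert K. induction n as [|n IH]; intros K Hadd Hscal Hopp Hzero.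
  - exists vzero. intros w a H.
    replace w with (@vzero 0) in * by (extensionality i; inversion i).
    rewrite inner_zero_l. auto.
  - destruct (IH (fun w a => K (vcons 0 w) a)) as [u' Hu'].
    + intros w a w' a' H1 H2.
      replace (vcons 0 (vadd w w')) with (vadd (vcons 0 w) (vcons 0 w')); [auto|].
      apply vec_S_ext; [|reflexivity]. unfold vadd; simpl; ring.
    + intros t w a Ht H. replace (vcons 0 (vscal t w)) with (vscal t (vcons 0 w)); [auto|].
      apply vec_S_ext; [|reflexivity]. unfold vscal; simpl; ring.
    + intros w a H. replace (vcons 0 (vopp w)) with (vopp (vcons 0 w)); [eauto|].
      apply vec_S_ext; [|reflexivity]. unfold vopp; simpl; ring.
    + intros a H. apply Hzero. replace (@vzero (S n)) with (vcons 0 (@vzero n)); [auto|].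
      apply vec_S_ext; reflexivity.
    + assert (H0 : forall w a, K w a -> w Fin.F1 = 0 -> inner u' (vtail w) <= a).
      { intros w a H Hw. apply Hu'. replace (vcons 0 (vtail w)) with w; [auto|].
        apply vec_S_ext; [exact Hw|reflexivity]. }
      destruct (classic (exists w a, K w a /\ w Fin.F1 = 1)) as [[w1 [a1 [Hw1 Hw1']]]|Hno].
      (* The new coordinate is the supremum of the lower bounds forced by vectors of first
         coordinate [-1]. Adding such a vector to [w1] lands in the slice treated by [H0], which
         bounds the set. *)
      * destruct (completeness
          (fun r => exists w b, K w b /\ w Fin.F1 = -1 /\ r = inner u' (vtail w) - b))
          as [u1 [Hub Hlub]].
        { exists (a1 - inner u' (vtail w1)). intros r [w [b [Hw [Hw' ->]]]].
          pose proof (H0 _ _ (Hadd _ _ _ _ Hw Hw1)) as H.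
          change (vtail (vadd w w1)) with (vadd (vtail w) (vtail w1)) in H.
          rewrite inner_add_r in H. unfold vadd in H. lra. }
        { destruct (Hopp _ _ Hw1) as [b Hb]. eexists; exists (vopp w1), b.
          split; [exact Hb|split; [unfold vopp; lra|reflexivity]]. }
        exists (vcons u1 u'). intros w a Hw. rewrite inner_S.
        change (vtail (vcons u1 u')) with u'. simpl.
        (* Positive rescaling reduces the nonzero cases to first coordinate [-1] or [1]. *)
        destruct (Rtotal_order (w Fin.F1) 0) as [Hs|[Hs|Hs]].
        -- assert (Hp : 0 < / - w Fin.F1) by (apply Rinv_0_lt_compat; lra).
           pose proof (Hscal _ _ _ Hp Hw) as Hk.
           assert (Hr : inner u' (vtail (vscal (/ - w Fin.F1) w)) - / - w Fin.F1 * a <= u1).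
           { apply Hub. eexists; eexists; split; [exact Hk|split; [|reflexivity]].
             unfold vscal. field. lra. }
           change (vtail (vscal (/ - w Fin.F1) w)) with (vscal (/ - w Fin.F1) (vtail w)) in Hr.
           rewrite inner_scal_r in Hr.
           apply (Rmult_le_compat_l (- w Fin.F1)) in Hr; [|lra].
           rewrite Rmult_minus_distr_l, <- !Rmult_assoc, Rinv_r in Hr; lra.
        -- rewrite Hs. pose proof (H0 _ _ Hw Hs). lra.
        -- assert (Hp : 0 < / w Fin.F1) by (apply Rinv_0_lt_compat; lra).
           pose proof (Hscal _ _ _ Hp Hw) as Hk.
           assert (Hr : u1 <= / w Fin.F1 * a - inner u' (vtail (vscal (/ w Fin.F1) w))).
           { apply Hlub. intros r [w2 [b [Hw2 [Hw2' ->]]]].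
             assert (Hf : vadd w2 (vscal (/ w Fin.F1) w) Fin.F1 = 0)
               by (unfold vadd, vscal; rewrite Hw2'; field; lra).
             pose proof (H0 _ _ (Hadd _ _ _ _ Hw2 Hk) Hf) as H.
             change (vtail (vadd w2 (vscal (/ w Fin.F1) w)))
               with (vadd (vtail w2) (vtail (vscal (/ w Fin.F1) w))) in H.
             rewrite inner_add_r in H. lra. }
           change (vtail (vscal (/ w Fin.F1) w)) with (vscal (/ w Fin.F1) (vtail w)) in Hr.
           rewrite inner_scal_r in Hr.
           apply (Rmult_le_compat_l (w Fin.F1)) in Hr; [|lra].
           rewrite Rmult_minus_distr_l, <- !Rmult_assoc, Rinv_r in Hr; lra.
      (* By scaling no first coordinate is positive, and by [Hopp] none is negative: the domain of
         [K] lies in the hyperplane, so the new coordinate can be 0. *)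
      * assert (Hnp : forall w a, K w a -> ~ 0 < w Fin.F1).
        { intros w a Hw Hs. apply Hno. exists (vscal (/ w Fin.F1) w), (/ w Fin.F1 * a).
          split; [apply Hscal; auto using Rinv_0_lt_compat|].
          unfold vscal. field. lra. }
        exists (vcons 0 u'). intros w a Hw. rewrite inner_S.
        change (vtail (vcons 0 u')) with u'. simpl.
        assert (w Fin.F1 = 0).
        { destruct (Hopp _ _ Hw) as [b Hb]. apply Hnp in Hw. apply Hnp in Hb.
          unfold vopp in Hb. lra. }
        pose proof (H0 _ _ Hw H). lra.
Qed.

(** The point is the affine combination $(1+s)y-sx$, and it tends to $y$ as $s\to0$. *)
Lemma ri_prolong N (A : set N) y x : ri A y -> A x ->
  exists t, 0 < t /\ forall s, 0 < s <= t -> A (vsub y (vscal s (vsub x y))).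
Proof.
  intros [Hy [e [He H]]] Hx. pose proof (norm_ge0 _ (vsub x y)).
  (* The [1 +] covers the case [x = y], where the norm vanishes. *)
  exists (e / 2 / (1 + norm (vsub x y))). split; [apply Rdiv_lt_0_compat; lra|].
  intros s [Hs1 Hs2]. apply H.
  - exists ((1 + s, y) :: (- s, x) :: nil). split; [repeat constructor; auto|].
    split; simpl; [ring|]. vec_ring.
  - replace (vsub (vsub y (vscal s (vsub x y))) y) with (vscal (- s) (vsub x y)) by vec_ring.
    rewrite norm_scal, Rabs_Ropp, Rabs_right by lra.
    assert (s * (1 + norm (vsub x y)) <= e / 2).
    { apply (Rmult_le_compat_r (1 + norm (vsub x y))) in Hs2; [|lra].
      replace (e / 2 / (1 + norm (vsub x y)) * (1 + norm (vsub x y))) with (e / 2) in Hs2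
        by (field; lra). lra. }
    nra.
Qed.

(* The cone K below is the epigraph of the directional derivative at 0 of
   w |-> inf_x f(x) + g(x + w); the qualification condition makes its domain a subspace. *)
Lemma argmin_sum_subdiff N (f g : vec N -> ext) x0 :
  convex f -> convex g -> (exists y, ri (dom f) y /\ ri (dom g) y) ->
  argmin_sum f g x0 -> exists u, subdiff g x0 u /\ subdiff f x0 (vopp u).
Proof.
  intros Hcf Hcg [y0 [Hyf Hyg]] [m [Hm Hmin]].
  destruct (linear_minorant N (fun w a => exists t x y fx gy, 0 < t /\ f x = Some fx /\
    g y = Some gy /\ vscal t w = vsub y x /\ fx + gy - m <= t * a)) as [u Hu].
  - intros w a w' a' [t [x [y [fx [gy [Ht [Hfx [Hgy [Hw Ha]]]]]]]]]
      [t' [x' [y' [fx' [gy' [Ht' [Hfx' [Hgy' [Hw' Ha']]]]]]]]].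
    (* The weight is chosen so that $qt=(1-q)t'$: the convex combinations of the base points then
       represent [vadd w w'] with the single step $qt$. *)
    set (q := t' / (t + t')).
    assert (Hq1 : 1 - q = t / (t + t')) by (unfold q; field; lra).
    assert (Hq : 0 < q < 1).
    { assert (0 < q) by (apply Rdiv_lt_0_compat; lra).
      assert (0 < 1 - q) by (rewrite Hq1; apply Rdiv_lt_0_compat; lra). lra. }
    pose proof (Hcf x x' fx fx' q Hq Hfx Hfx') as H1.
    pose proof (Hcg y y' gy gy' q Hq Hgy Hgy') as H2.
    destruct (f (vadd (vscal q x) (vscal (1 - q) x'))) as [F|] eqn:HF; simpl in H1; [|contradiction].
    destruct (g (vadd (vscal q y) (vscal (1 - q) y'))) as [G|] eqn:HG; simpl in H2; [|contradiction].
    assert (Ett : q * t = (1 - q) * t') by (rewrite Hq1; unfold q; field; lra).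
    exists (q * t), (vadd (vscal q x) (vscal (1 - q) x')), (vadd (vscal q y) (vscal (1 - q) y')), F, G.
    split; [nra|]. split; [auto|]. split; [auto|]. split.
    + extensionality i. apply (f_equal (fun h => h i)) in Hw. apply (f_equal (fun h => h i)) in Hw'.
      unfold vscal, vsub, vadd in *.
      replace (q * t * (w i + w' i)) with (q * (t * w i) + (q * t) * w' i) by ring.
      rewrite Ett, Hw. replace ((1 - q) * t' * w' i) with ((1 - q) * (t' * w' i)) by ring.
      rewrite Hw'. ring.
    + replace (q * t * (a + a')) with (q * (t * a) + (q * t) * a') by ring. rewrite Ett.
      replace ((1 - q) * t' * a') with ((1 - q) * (t' * a')) by ring. nra.
  - intros s w a Hs [t [x [y [fx [gy [Ht [Hfx [Hgy [Hw Ha]]]]]]]]].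
    exists (t / s), x, y, fx, gy. split; [apply Rdiv_lt_0_compat; auto|].
    repeat (split; [assumption|]). split.
    + rewrite <- Hw. extensionality i. unfold vscal. field. lra.
    + replace (t / s * (s * a)) with (t * a) by (field; lra). auto.
  - intros w a [t [x [y [fx [gy [Ht [Hfx [Hgy [Hw Ha]]]]]]]]].
    (* Pushing [x] and [y] through [y0] with a common [s] gives two points of finite value whose
       difference is $-s(y-x)=-(st)w$. *)
    destruct (ri_prolong _ _ _ x Hyf) as [s1 [Hs1 H1]]; [unfold dom; congruence|].
    destruct (ri_prolong _ _ _ y Hyg) as [s2 [Hs2 H2]]; [unfold dom; congruence|].
    set (s := Rmin s1 s2). assert (Hs : 0 < s) by now apply Rmin_glb_lt.
    specialize (H1 s (conj Hs (Rmin_l _ _))). specialize (H2 s (conj Hs (Rmin_r _ _))).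
    unfold dom in *.
    destruct (f (vsub y0 (vscal s (vsub x y0)))) as [F|] eqn:HF; [|congruence].
    destruct (g (vsub y0 (vscal s (vsub y y0)))) as [G|] eqn:HG; [|congruence].
    exists ((F + G - m) / (s * t)), (s * t), (vsub y0 (vscal s (vsub x y0))),
      (vsub y0 (vscal s (vsub y y0))), F, G.
    split; [nra|]. split; [auto|]. split; [auto|]. split.
    + extensionality i. apply (f_equal (fun h => h i)) in Hw. unfold vscal, vsub, vopp in *.
      replace (s * t * - w i) with (- s * (t * w i)) by ring. rewrite Hw. ring.
    + right. field. lra.
  - intros a [t [x [y [fx [gy [Ht [Hfx [Hgy [Hw Ha]]]]]]]]].
    assert (y = x).
    { extensionality i. apply (f_equal (fun h => h i)) in Hw. unfold vscal, vsub, vzero in Hw. lra. }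
    subst y. specialize (Hmin x). rewrite Hfx, Hgy in Hmin. simpl in Hmin. nra.
  - exists u. destruct (f x0) as [f0|] eqn:Hf0; [|discriminate].
    destruct (g x0) as [g0|] eqn:Hg0; [|discriminate]. simpl in Hm. injection Hm as <-. split.
    (* Freezing the point of [f] at [x0], with $t=1$, isolates the inequality for [g]; the other
       half freezes the point of [g]. *)
    + exists g0. split; [auto|]. intros y. destruct (g y) as [gy|] eqn:Hy; simpl; [|auto].
      assert (inner u (vsub y x0) <= f0 + gy - (f0 + g0)); [|lra].
      apply Hu. exists 1, x0, y, f0, gy. repeat (split; [auto; lra|]). split; [vec_ring|lra].
    + exists f0. split; [auto|]. intros x. destruct (f x) as [fx|] eqn:Hx; simpl; [|auto].
      assert (H : inner u (vsub x0 x) <= fx + g0 - (f0 + g0)).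
      { apply Hu. exists 1, x, x0, fx, g0. repeat (split; [auto; lra|]). split; [vec_ring|lra]. }
      inner_expand_in H. inner_expand. lra.
Qed.

Lemma subdiff_argmin_sum N (f g : vec N -> ext) x u :
  subdiff g x u -> subdiff f x (vopp u) -> argmin_sum f g x.
Proof.
  intros [gx [Hg H1]] [fx [Hf H2]]. exists (fx + gx). rewrite Hf, Hg. split; [auto|].
  intros y. specialize (H1 y). specialize (H2 y).
  destruct (f y) as [fy|]; simpl in *; [|auto].
  destruct (g y) as [gy|]; simpl in *; [|auto].
  rewrite inner_opp_l in H2. lra.
Qed.

(** * Relative interiors of convex sets *)

Definition lincomb {N} (l : list (R * vec N)) : vec N :=
  fold_right (fun p acc => vadd (vscal (fst p) (snd p)) acc) vzero l.

Lemma lincomb_cons N p (l : list (R * vec N)) :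
  lincomb (p :: l) = vadd (vscal (fst p) (snd p)) (lincomb l).
Proof. reflexivity. Qed.

(** Each pair is a coordinate functional with its vector. If the vectors lie in [A] and every
    element of [A] is fixed, the fixed vectors form exactly the span of [A], so membership in the
    span becomes an equation. *)
Definition expand {N} (l : list (vec N * vec N)) (w : vec N) : vec N :=
  lincomb (map (fun q => (inner (fst q) w, snd q)) l).

Lemma expand_comb N (l : list (vec N * vec N)) s a t b :
  expand l (vadd (vscal s a) (vscal t b)) = vadd (vscal s (expand l a)) (vscal t (expand l b)).
Proof.
  unfold expand. induction l as [|q l IH]; simpl.
  - vec_ring.
  - rewrite IH. inner_expand. vec_ring.
Qed.

(* Gaussian elimination on the first coordinate, pivoting on some d in A. *)
Lemma frame_exists N (A : set N) : exists l : list (vec N * vec N),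
  Forall (fun q => A (snd q)) l /\ forall w, A w -> expand l w = w.
Proof.
  revert A. induction N as [|n IH]; intros A.
  - exists nil. split; [constructor|]. intros w _. extensionality i. inversion i.
  - destruct (classic (exists d, A d /\ d Fin.F1 <> 0)) as [[d [Hd Hd1]]|Hno].
    (* Subtracting a multiple of the pivot kills the first coordinate; [red] is the remaining tail
       and its kernel is the line spanned by [d]. *)
    + set (red := fun w : vec (S n) => vsub (vtail w) (vscal (w Fin.F1 / d Fin.F1) (vtail d))).
      destruct (IH (fun w' => exists w, A w /\ w' = red w)) as [l' [Hl' Hexp]].
      assert (Hl2 : exists l2 : list (vec n * vec (S n)), Forall (fun q => A (snd q)) l2 /\
                l' = map (fun q => (fst q, red (snd q))) l2).
      { clear Hexp. induction Hl' as [|[p w'] l' [w [Hw Hww]] _ [l2 [H1 H2]]].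
        - exists nil. split; [constructor|reflexivity].
        - exists ((p, w) :: l2). split; [constructor; auto|]. simpl in *. now rewrite H2, Hww. }
      destruct Hl2 as [l2 [HA ->]]. clear Hl'.
      (* The adjoint of [red], turning functionals on tails into functionals on full vectors. *)
      set (lift := fun p : vec n => vcons (- inner p (vtail d) / d Fin.F1) p).
      assert (Hlift : forall p w, inner (lift p) w = inner p (red w)).
      { intros p w. rewrite inner_S. unfold red. change (vtail (lift p)) with p.
        rewrite inner_sub_r, inner_scal_r. simpl. field. auto. }
      (* Since [W w] below has the same image under [red] as [w], the two differ by a multiple of
         [d]; [p0] computes that multiple from their first coordinates. *)
      set (p0 := vsub (vcons (/ d Fin.F1) vzero)
                   (lincomb (map (fun q : vec n * vec (S n) => (snd q Fin.F1 / d Fin.F1, lift (fst q))) l2))).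
      set (W := fun w => lincomb (map (fun q => (inner (fst q) (red w), snd q)) l2)).
      exists ((p0, d) :: map (fun q => (lift (fst q), snd q)) l2). split.
      * constructor; [exact Hd|]. apply Forall_map. exact HA.
      * intros w Hw.
        assert (Hred : red (W w) = red w).
        { rewrite <- (Hexp (red w)) by eauto. unfold W, expand. clear Hexp HA p0 W.
          generalize (red w) as w'. intros w'. induction l2 as [|q l2 IHl]; simpl.
          - extensionality i. unfold red, vtail, vsub, vscal, vzero. field. auto.
          - rewrite <- IHl. extensionality i. unfold red, vtail, vsub, vscal, vadd. field. auto. }
        assert (Hp0 : inner p0 w = (w Fin.F1 - W w Fin.F1) / d Fin.F1).
        { unfold p0. rewrite inner_sub_l, inner_S. change (vtail (vcons (/ d Fin.F1) vzero)) with (@vzero n).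
          rewrite inner_zero_l. simpl.
          assert (H : inner (lincomb (map (fun q : vec n * vec (S n) => (snd q Fin.F1 / d Fin.F1, lift (fst q))) l2)) w
                   = W w Fin.F1 / d Fin.F1).
          { unfold W. clear HA Hexp p0 W Hred. induction l2 as [|q l2 IHl]; simpl.
            - rewrite inner_zero_l. unfold vzero. field. auto.
            - rewrite inner_add_l, inner_scal_l, IHl, Hlift. unfold vadd, vscal. field. auto. }
          rewrite H. field. auto. }
        unfold expand. simpl. rewrite map_map. simpl.
        replace (map (fun q => (inner (lift (fst q)) w, snd q)) l2)
          with (map (fun q => (inner (fst q) (red w), snd q)) l2)
          by (apply map_ext; intros q; now rewrite Hlift).
        fold (W w). rewrite Hp0. apply vec_S_ext.
        -- unfold vadd, vscal. field. auto.
        -- extensionality i. apply (f_equal (fun h => h i)) in Hred.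
           unfold red, vtail, vsub, vscal, vadd in *.
           apply (Rplus_eq_reg_l (- (w Fin.F1 / d Fin.F1 * d (Fin.FS i)))).
           replace (- (w Fin.F1 / d Fin.F1 * d (Fin.FS i)) + w (Fin.FS i))
             with (w (Fin.FS i) - w Fin.F1 / d Fin.F1 * d (Fin.FS i)) by ring.
           rewrite <- Hred. field. auto.
    + assert (H0 : forall w, A w -> w = vcons 0 (vtail w)).
      { intros w Hw. apply vec_S_ext; [|reflexivity]. simpl. apply NNPP. intros H. apply Hno. eauto. }
      destruct (IH (fun w' => A (vcons 0 w'))) as [l' [Hl' Hexp]].
      exists (map (fun q => (vcons 0 (fst q), vcons 0 (snd q))) l'). split.
      * apply Forall_map. exact Hl'.
      * intros w Hw. rewrite (H0 w Hw) in Hw |- *.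
        rewrite <- (Hexp (vtail w)) at 2 by exact Hw.
        generalize (vtail w). intros w'. clear. unfold expand. rewrite map_map. simpl.
        induction l' as [|q l' IHl]; simpl.
        -- apply vec_S_ext; reflexivity.
        -- rewrite IHl, inner_S.
           change (vtail (vcons 0 (fst q))) with (fst q). change (vtail (vcons 0 w')) with w'.
           apply vec_S_ext; [|extensionality i]; unfold vtail, vadd, vscal; simpl; ring.
Qed.

Definition convex_set {N} (C : set N) : Prop :=
  forall a b t, 0 <= t <= 1 -> C a -> C b -> C (vadd (vscal t a) (vscal (1 - t) b)).

Definition weight {N} (l : list (R * vec N)) : R := fold_right (fun p s => fst p + s) 0 l.

(** The weight missing to reach 1 is placed on the origin. *)
Lemma convex_set_lincomb N (A : set N) (l : list (R * vec N)) :
  convex_set A -> A vzero -> Forall (fun p => 0 <= fst p /\ A (snd p)) l ->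
  weight l <= 1 -> A (lincomb l).
Proof.
  intros HA H0 Hl Hw.
  assert (H : 0 <= weight l /\ exists a, A a /\ lincomb l = vscal (weight l) a).
  { clear Hw. induction Hl as [|p l [Hp1 Hp2] _ [Hs [a [Ha Hla]]]]; simpl.
    - split; [lra|]. exists vzero. split; [auto|]. vec_ring.
    - split; [lra|]. rewrite Hla. set (s := weight l) in *.
      (* A zero total forces both nonnegative weights to vanish; otherwise one can normalise by
         it. *)
      destruct (Req_dec (fst p + s) 0) as [Hz|Hnz].
      + exists vzero. split; [auto|]. replace (fst p) with 0 by lra. replace s with 0 by lra. vec_ring.
      + exists (vadd (vscal (fst p / (fst p + s)) (snd p)) (vscal (1 - fst p / (fst p + s)) a)).
        split.
        * apply HA; [|auto|auto]. split.
          -- apply Rle_mult_inv_pos; lra.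
          -- apply (Rmult_le_reg_r (fst p + s)); [lra|]. unfold Rdiv.
             rewrite Rmult_assoc, Rinv_l; lra.
        * extensionality i. unfold vadd, vscal. field. auto. }
  destruct H as [Hs [a [Ha ->]]].
  replace (vscal (weight l) a) with (vadd (vscal (weight l) a) (vscal (1 - weight l) vzero)) by vec_ring.
  apply HA; [lra|auto|auto].
Qed.

(* Near u, the points u + s * sum_j d_j, for a frame (d_j) of C - u and small s > 0,
   lie in the relative interior. *)
Lemma convex_subset_cl_ri N (C : set N) : convex_set C -> subset C (cl (ri C)).
Proof.
  intros HC u Hu e He.
  set (A := fun w => C (vadd u w)).
  assert (HA : convex_set A).
  { intros a b t Ht Ha Hb. unfold A in *.
    replace (vadd u (vadd (vscal t a) (vscal (1 - t) b)))
      with (vadd (vscal t (vadd u a)) (vscal (1 - t) (vadd u b))) by vec_ring. auto. }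
  assert (HA0 : A vzero) by (unfold A; replace (vadd u vzero) with u by vec_ring; auto).
  destruct (frame_exists N A) as [l [Hl Hexp]].
  set (D := lincomb (map (fun q => (1, snd q)) l)).
  assert (HD : expand l D = D).
  { unfold D. assert (Hgen : forall l0, Forall (fun q => A (snd q)) l0 ->
      expand l (lincomb (map (fun q : vec N * vec N => (1, snd q)) l0))
        = lincomb (map (fun q => (1, snd q)) l0)); [|auto].
    intros l0 H. induction H as [|q l0 Hq _ IH]; [apply Hexp; auto|].
    cbn [map]. rewrite lincomb_cons. cbn [fst snd].
    set (r := lincomb (map _ l0)) in *.
    replace (vadd (vscal 1 (snd q)) r) with (vadd (vscal 1 (snd q)) (vscal 1 r)) by vec_ring.
    now rewrite expand_comb, IH, Hexp. }
  assert (HL : exists L, 1 <= L /\ Forall (fun q => norm (fst q) <= L) l).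
  { clear. induction l as [|q l [L [HL1 HL2]]].
    - exists 1. split; [lra|constructor].
    - pose proof (norm_ge0 _ (fst q)). exists (L + norm (fst q)). split; [lra|].
      constructor; [lra|]. eapply Forall_impl; [|exact HL2]. simpl; intros; lra. }
  destruct HL as [L [HL1 HL2]].
  set (m := INR (length l)). assert (Hm : 0 <= m) by apply pos_INR.
  pose proof (norm_ge0 _ D) as HnD.
  (* Two demands on [s]: the displacement $sD$ is shorter than [e], and [m] weights of size at most
     $2s$ have sum at most 1. *)
  assert (Hs : exists s, 0 < s /\ s * norm D < e /\ 2 * s * m <= 1).
  { exists (Rmin (e / (1 + norm D)) (/ (2 * (m + 1)))).
    assert (H1 : 0 < e / (1 + norm D)) by (apply Rdiv_lt_0_compat; lra).
    assert (H2 : 0 < / (2 * (m + 1))) by (apply Rinv_0_lt_compat; lra).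
    set (s := Rmin _ _). assert (Hs0 : 0 < s) by now apply Rmin_glb_lt.
    assert (Hs1 : s <= e / (1 + norm D)) by apply Rmin_l.
    assert (Hs2 : s <= / (2 * (m + 1))) by apply Rmin_r.
    apply (Rmult_le_compat_r (1 + norm D)) in Hs1; [|lra].
    replace (e / (1 + norm D) * (1 + norm D)) with e in Hs1 by (field; lra).
    apply (Rmult_le_compat_r (2 * (m + 1))) in Hs2; [|lra].
    rewrite Rinv_l in Hs2 by lra. split; [auto|]. split; nra. }
  destruct Hs as [s [Hs [HsD Hsm]]].
  (* For such [h], the vector $sD+h$ has frame coefficients $s+\langle p_j,h\rangle$ in $[0,2s]$, so
     [convex_set_lincomb] applies. *)
  assert (Hnear : forall h, expand l h = h -> norm h < s / L -> C (vadd (vadd u (vscal s D)) h)).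
  { intros h Hh Hnh.
    replace (vadd (vadd u (vscal s D)) h)
      with (vadd u (lincomb (map (fun q => (s + inner (fst q) h, snd q)) l))).
    - apply (convex_set_lincomb _ A); [auto|auto| |].
      + apply Forall_map. apply Forall_forall. intros q Hq. simpl.
        rewrite Forall_forall in Hl, HL2. split; [|auto].
        specialize (HL2 q Hq). pose proof (cauchy_schwarz _ (fst q) h) as Hcs.
        pose proof (norm_ge0 _ h). pose proof (norm_ge0 _ (fst q)).
        pose proof (Rle_abs (- inner (fst q) h)) as Ha. rewrite Rabs_Ropp in Ha.
        assert (L * norm h < s).
        { apply (Rmult_lt_compat_l L) in Hnh; [|lra].
          replace (L * (s / L)) with s in Hnh by (field; lra). auto. }
        nra.
      + apply Rle_trans with (2 * s * m); [|auto]. unfold m. clear - HL2 HL1 Hnh Hs.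
        induction HL2 as [|q l Hq _ IH]; [simpl; lra|].
        cbn [map weight fold_right fst length]. rewrite S_INR.
        fold (weight (map (fun q : vec N * vec N => (s + inner (fst q) h, snd q)) l)).
        pose proof (cauchy_schwarz _ (fst q) h) as Hcs.
        pose proof (norm_ge0 _ h). pose proof (norm_ge0 _ (fst q)).
        pose proof (Rle_abs (inner (fst q) h)) as Ha.
        assert (L * norm h < s).
        { apply (Rmult_lt_compat_l L) in Hnh; [|lra].
          replace (L * (s / L)) with s in Hnh by (field; lra). auto. }
        nra.
    - replace (lincomb (map (fun q => (s + inner (fst q) h, snd q)) l)) with (vadd (vscal s D) h);
        [vec_ring|].
      rewrite <- Hh at 1. unfold D, expand. clear. induction l as [|q l IH]; simpl; [vec_ring|].
      rewrite <- IH. vec_ring. }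
  exists (vadd u (vscal s D)). split.
  - split.
    + replace (vadd u (vscal s D)) with (vadd (vadd u (vscal s D)) vzero) by vec_ring.
      apply Hnear; [auto|].
      unfold norm. rewrite inner_zero_l, sqrt_0. apply Rdiv_lt_0_compat; lra.
    + exists (s / L). split; [apply Rdiv_lt_0_compat; lra|].
      intros y [l0 [Hl0 [Hw Hy]]] Hn.
      replace y with (vadd (vadd u (vscal s D)) (vsub y (vadd u (vscal s D)))) by vec_ring.
      apply Hnear; [|auto].
      (* As the affine weights of [y] sum to 1, $y-u$ is a combination of differences $a_i-u$, each
         fixed by [expand l]. The induction carries the partial weight in place of 1. *)
      assert (Hyu : expand l (vsub y u) = vsub y u).
      { replace (vsub y u) with (vsub y (vscal (weight l0) u))
          by (unfold weight; rewrite Hw; vec_ring).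
        rewrite Hy. fold (lincomb l0). clear Hw Hy Hn.
        induction Hl0 as [|p l0 Hp _ IH]; simpl.
        - replace (vsub vzero (vscal 0 u)) with (@vzero N) by vec_ring. auto.
        - replace (vsub (vadd (vscal (fst p) (snd p)) (lincomb l0)) (vscal (fst p + weight l0) u))
            with (vadd (vscal (fst p) (vsub (snd p) u))
                       (vscal 1 (vsub (lincomb l0) (vscal (weight l0) u)))) by vec_ring.
          rewrite expand_comb, IH, (Hexp (vsub (snd p) u)); [auto|].
          unfold A. replace (vadd u (vsub (snd p) u)) with (snd p) by vec_ring. auto. }
      replace (vsub y (vadd u (vscal s D)))
        with (vadd (vscal 1 (vsub y u)) (vscal (- s) D)) by vec_ring.
      now rewrite expand_comb, HD, Hyu.
  - replace (vsub (vadd u (vscal s D)) u) with (vscal s D) by vec_ring.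
    rewrite norm_scal, Rabs_right by lra. auto.
Qed.

(** * Identification of strata *)

Lemma cl_subset N (A B : set N) : subset A B -> subset (cl A) (cl B).
Proof. intros H x Hx e He. destruct (Hx e He) as [y [Hy Hn]]. exists y. auto. Qed.

Lemma subset_cl N (A : set N) : subset A (cl A).
Proof.
  intros x Hx e He. exists x. split; [auto|].
  replace (vsub x x) with (@vzero N) by vec_ring. unfold norm. now rewrite inner_zero_l, sqrt_0.
Qed.

(** A set whose closure misses [l] stays at positive distance from [l]; finiteness of the list gives
    one rank for all its members. *)
Lemma cl_list_eventually N (Ms : list (set N)) s l : conv s l ->
  exists K, forall k, (K <= k)%nat -> forall M, In M Ms -> cl M (s k) -> cl M l.
Proof.
  intros Hs. induction Ms as [|M Ms [K1 HK1]].
  - exists O. intros k _ M [].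
  - destruct (classic (cl M l)) as [HM|HM].
    + exists K1. intros k Hk M' [<-|HM'] H; [auto|]. eapply HK1; eauto.
    + apply not_all_ex_not in HM. destruct HM as [e HM].
      apply imply_to_and in HM. destruct HM as [He HM].
      destruct (Hs (e / 2)) as [K2 HK2]; [lra|]. exists (max K1 K2).
      intros k Hk M' [<-|HM'] H; [|apply (HK1 k); auto; lia].
      exfalso. apply HM. destruct (H (e / 2)) as [y [Hy Hn]]; [lra|].
      exists y. split; [auto|]. specialize (HK2 k ltac:(lia)).
      pose proof (norm_triangle_sub _ y (s k) l). lra.
Qed.

(** Common core of both claims, for any convergent sequence in the graph of the subdifferential. *)
Lemma mirror_strat_identification N (h : vec N -> ext) S Ss (xk uk : nat -> vec N) x u :
  mirror_strat h S Ss -> conv xk x -> conv uk u ->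
  (forall k, subdiff h (xk k) (uk k)) ->
  exists K, forall k, (K <= k)%nat ->
    forall M1 M2 M3, stratum S x M1 -> stratum S (xk k) M2 -> stratum Ss u M3 ->
      strat_le M1 M2 /\ strat_le M2 (J (conjf h) M3).
Proof.
  intros [[_ [_ [_ HS]]] [[_ [_ [_ HSs]]] [HJ [HJs [Hinv Hord]]]]] Hx Hu Hsub.
  destruct (cl_list_eventually _ S _ _ Hx) as [K1 HK1].
  destruct (cl_list_eventually _ Ss _ _ Hu) as [K2 HK2].
  exists (max K1 K2). intros k Hk M1 M2 M3 [HM1 HM1x] [HM2 HM2x] [HM3 HM3u]. split.
  - apply HS; [auto|auto|]. exists x. split; [auto|].
    apply (HK1 k); [lia|auto|]. now apply subset_cl.
  - destruct (HJ M2 HM2) as [Ms2 [HMs2 Heq2]].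
    destruct (HJs M3 HM3) as [M' [HM' Heq']].
    assert (Heq3 : set_eq M3 (J h M')).
    { apply Hinv; [auto|auto|]. intros w; symmetry; apply Heq'. }
    (* [Ms2] is the image of [M2], so it contains the relative interior of the subdifferential at
       [xk k], whose closure contains [uk k]. *)
    assert (Hle : strat_le M3 Ms2).
    { apply HSs; [auto|auto|]. exists u. split; [auto|]. apply (HK2 k); [lia|auto|].
      apply (cl_subset _ (ri (subdiff h (xk k)))).
      - intros w Hw. apply Heq2. exists (xk k). auto.
      - apply convex_subset_cl_ri; [|apply Hsub].
        intros a b t Ht Ha Hb. now apply subdiff_convex. }
    (* Order reversal turns the dual relation between [M3] and [Ms2] into one between their primal
       partners. *)
    assert (Hle' : strat_le M2 M').
    { apply Hord; [auto|auto|]. intros w Hw. apply (cl_subset _ Ms2).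
      - intros y Hy. now apply Heq2.
      - apply Hle. now apply Heq3. }
    intros w Hw. apply (cl_subset _ M'); [intros y Hy; now apply Heq'|]. now apply Hle'.
Qed.

(** * Douglas-Rachford iteration *)

Lemma resolvent_firmly_nonexpansive N gamma (h : vec N -> ext) z p z' p' : 0 < gamma ->
  subdiff h p (vscal (/ gamma) (vsub z p)) -> subdiff h p' (vscal (/ gamma) (vsub z' p')) ->
  0 <= inner (vsub (vsub z z') (vsub p p')) (vsub p p').
Proof.
  intros Hg H H'. pose proof (subdiff_monotone _ _ _ _ _ _ H H') as Hm.
  replace (vsub (vscal (/ gamma) (vsub z p)) (vscal (/ gamma) (vsub z' p')))
    with (vscal (/ gamma) (vsub (vsub z z') (vsub p p'))) in Hm by vec_ring.
  rewrite inner_scal_l in Hm. apply Rinv_0_lt_compat in Hg.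
  apply (Rmult_le_reg_l (/ gamma)); lra.
Qed.

Lemma resolvent_nonexpansive N gamma (h : vec N -> ext) z p z' p' : 0 < gamma ->
  subdiff h p (vscal (/ gamma) (vsub z p)) -> subdiff h p' (vscal (/ gamma) (vsub z' p')) ->
  norm (vsub p p') <= norm (vsub z z').
Proof.
  intros Hg H H'. pose proof (resolvent_firmly_nonexpansive _ _ _ _ _ _ _ Hg H H') as Hm.
  rewrite inner_sub_l, <- norm_sqr in Hm.
  pose proof (cauchy_schwarz _ (vsub z z') (vsub p p')) as Hcs.
  pose proof (Rle_abs (inner (vsub z z') (vsub p p'))).
  pose proof (norm_ge0 _ (vsub p p')). pose proof (norm_ge0 _ (vsub z z')). nra.
Qed.

(** The proximal relations in subgradient form, to which closedness of the graph applies directly.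
    [dr_step gamma f g z x x] expresses that [z] is a fixed point with proximal image [x]. *)
Definition dr_step {N} gamma (f g : vec N -> ext) (z x v : vec N) : Prop :=
  subdiff g x (vscal (/ gamma) (vsub z x)) /\
  subdiff f v (vscal (/ gamma) (vsub (vsub (vscal 2 x) z) v)).

(* Equivalently, z |-> z + 2 (v - x) is nonexpansive. *)
Lemma dr_step_cocoercive N gamma (f g : vec N -> ext) z x v z' x' v' : 0 < gamma ->
  dr_step gamma f g z x v -> dr_step gamma f g z' x' v' ->
  let r := vsub (vsub v x) (vsub v' x') in inner r r + inner (vsub z z') r <= 0.
Proof.
  intros Hg [H1 H2] [H1' H2'].
  pose proof (resolvent_firmly_nonexpansive _ _ _ _ _ _ _ Hg H1 H1') as Ha.
  pose proof (resolvent_firmly_nonexpansive _ _ _ _ _ _ _ Hg H2 H2') as Hb.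
  intros r.
  set (dz := vsub z z') in *. set (dx := vsub x x') in *. set (dv := vsub v v') in *.
  replace (vsub (vsub (vscal 2 x) z) (vsub (vscal 2 x') z')) with (vsub (vscal 2 dx) dz) in Hb
    by (unfold dx, dz; vec_ring).
  replace r with (vsub dv dx) by (unfold r, dv, dx; vec_ring).
  (* The sum of [Ha] and [Hb] is exactly the claim once expanded. *)
  inner_expand_in Ha. inner_expand_in Hb. inner_expand.
  rewrite (inner_comm _ dv dx) in *. lra.
Qed.

(** Here [q] stands for squared residuals and [d] for squared distances to a fixed point.
    Telescoping, with [q] nonincreasing, bounds [q n] times the partial sum by the total decrease of
    [d]. *)
Lemma krasnoselskii_mann_residual (tau q d : nat -> R) :
  (forall k, 0 < tau k < 2) ->
  cv_infty (fun n => sum_f_R0 (fun k => tau k * (2 - tau k)) n) ->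
  (forall k, 0 <= q k) -> (forall k, 0 <= d k) -> (forall k, q (S k) <= q k) ->
  (forall k, d (S k) <= d k - tau k * (2 - tau k) * q k) -> Un_cv q 0.
Proof.
  intros Ht Hinf Hq Hd Hdec Hf.
  assert (Hsum : forall n, q n * sum_f_R0 (fun k => tau k * (2 - tau k)) n <= d O - d (S n)).
  { induction n as [|n IH]; simpl.
    - specialize (Hf O). lra.
    - pose proof (Hf (S n)) as Hfn.
      assert (0 <= sum_f_R0 (fun k => tau k * (2 - tau k)) n)
        by (apply cond_pos_sum; intros k; specialize (Ht k); nra).
      pose proof (Hdec n).
      assert (q (S n) * sum_f_R0 (fun k => tau k * (2 - tau k)) n
              <= q n * sum_f_R0 (fun k => tau k * (2 - tau k)) n) by (apply Rmult_le_compat_r; auto).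
      lra. }
  (* Once the partial sum exceeds [d O / e], having [q n] at least [e] would make the product exceed
     [d O]. *)
  intros e He. destruct (Hinf (d O / e)) as [K HK]. exists K. intros n Hn.
  specialize (HK n Hn). specialize (Hsum n). pose proof (Hd (S n)). pose proof (Hd O).
  unfold Rdist. rewrite Rminus_0_r, Rabs_right by (apply Rle_ge; auto).
  set (T := sum_f_R0 _ n) in *. apply Rnot_le_lt. intros Hle.
  apply (Rmult_lt_compat_l e) in HK; [|auto].
  replace (e * (d O / e)) with (d O) in HK by (field; lra).
  assert (0 <= T) by (apply cond_pos_sum; intros k; specialize (Ht k); nra).
  nra.
Qed.

(** The given fixed point [zb] serves for boundedness and vanishing residuals; the limit may be
    another one, to which Fejer monotonicity is applied again. *)
Lemma dr_convergence N gamma (f g : vec N -> ext) (tau : nat -> R) (z x v : nat -> vec N) zb xb :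
  lsc f -> lsc g -> 0 < gamma -> (forall k, 0 < tau k < 2) ->
  cv_infty (fun n => sum_f_R0 (fun k => tau k * (2 - tau k)) n) ->
  (forall k, dr_step gamma f g (z k) (x k) (v (S k))) ->
  (forall k, z (S k) = vadd (z k) (vscal (tau k) (vsub (v (S k)) (x k)))) ->
  dr_step gamma f g zb xb xb ->
  exists zs xs, dr_step gamma f g zs xs xs /\ conv z zs /\ conv x xs /\
    conv (fun k => v (S k)) xs.
Proof.
  intros Hlf Hlg Hg Ht Hinf Hstep Hz Hb.
  set (r := fun k => vsub (v (S k)) (x k)).
  (* Expand $\|z_k-z_f+\tau_k r_k\|^2$; cocoercivity against the fixed point, whose residual is
     zero, bounds the cross term by $-2\tau_k\|r_k\|^2$. *)
  assert (Hfejer : forall zf xf, dr_step gamma f g zf xf xf -> forall k,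
    inner (vsub (z (S k)) zf) (vsub (z (S k)) zf)
      <= inner (vsub (z k) zf) (vsub (z k) zf) - tau k * (2 - tau k) * inner (r k) (r k)).
  { intros zf xf Hfix k.
    pose proof (dr_step_cocoercive _ _ _ _ _ _ _ _ _ _ Hg (Hstep k) Hfix) as H. simpl in H.
    replace (vsub (vsub (v (S k)) (x k)) (vsub xf xf)) with (r k) in H by (unfold r; vec_ring).
    replace (vsub (z (S k)) zf) with (vadd (vsub (z k) zf) (vscal (tau k) (r k)))
      by (rewrite Hz; unfold r; vec_ring).
    rewrite inner_add_l, !inner_add_r, !inner_scal_l, !inner_scal_r.
    rewrite (inner_comm _ (r k) (vsub (z k) zf)). specialize (Ht k). nra. }
  (* Cocoercivity between consecutive steps gives $\|dr\|^2+\tau_k\langle r_k,dr\rangle\le0$, and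
     $\tau_k<2$ then yields $2\langle r_k,dr\rangle+\|dr\|^2\le0$. *)
  assert (Hres : forall k, inner (r (S k)) (r (S k)) <= inner (r k) (r k)).
  { intros k.
    pose proof (dr_step_cocoercive _ _ _ _ _ _ _ _ _ _ Hg (Hstep (S k)) (Hstep k)) as H. simpl in H.
    fold (r k) in H. fold (r (S k)) in H.
    replace (vsub (z (S k)) (z k)) with (vscal (tau k) (r k)) in H by (rewrite Hz; unfold r; vec_ring).
    rewrite inner_scal_l in H.
    replace (r (S k)) with (vadd (r k) (vsub (r (S k)) (r k))) at 1 2 by vec_ring.
    set (dr := vsub (r (S k)) (r k)) in *.
    rewrite inner_add_l, !inner_add_r, (inner_comm _ dr (r k)).
    pose proof (inner_self_ge0 _ dr). specialize (Ht k).
    assert (2 * inner (r k) dr + inner dr dr <= 0) by (apply (Rmult_le_reg_l (tau k)); nra). lra. }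
  assert (Hr0 : conv r vzero).
  { assert (Hq : Un_cv (fun k => inner (r k) (r k)) 0).
    { apply (krasnoselskii_mann_residual tau _ (fun k => inner (vsub (z k) zb) (vsub (z k) zb)));
        eauto using inner_self_ge0. }
    intros e He. destruct (Hq (e * e)) as [K HK]; [nra|]. exists K. intros k Hk.
    specialize (HK k Hk). replace (vsub (r k) vzero) with (r k) by vec_ring.
    apply norm_lt; [lra|]. unfold Rdist in HK. apply Rabs_def2 in HK. lra. }
  assert (Hmono : forall zf xf, dr_step gamma f g zf xf xf -> forall k j,
    norm (vsub (z (j + k)%nat) zf) <= norm (vsub (z k) zf)).
  { intros zf xf Hfix k j. induction j as [|j IH]; [apply Rle_refl|].
    eapply Rle_trans; [|exact IH]. apply norm_le; [apply norm_ge0|]. rewrite norm_sqr.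
    pose proof (Hfejer _ _ Hfix (j + k)%nat). specialize (Ht (j + k)%nat).
    pose proof (inner_self_ge0 _ (r (j + k)%nat)). simpl.
    assert (0 <= tau (j + k)%nat * (2 - tau (j + k)%nat) * inner (r (j + k)%nat) (r (j + k)%nat))
      by (apply Rmult_le_pos; [nra|auto]). lra. }
  assert (Hzb : forall k, norm (vsub (z k) zb) <= norm (vsub (z O) zb)).
  { intros k. rewrite <- (Nat.add_0_r k) at 1. eapply Hmono; eauto. }
  assert (Hxb : forall k, norm (vsub (x k) xb) <= norm (vsub (z O) zb)).
  { intros k. eapply Rle_trans; [|apply (Hzb k)].
    eapply resolvent_nonexpansive; [exact Hg|apply Hstep|apply Hb]. }
  assert (Hbd : forall (s : nat -> vec N) c B, (forall k, norm (vsub (s k) c) <= B) ->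
    forall k, norm (s k) <= B + norm c).
  { intros s c B H k. replace (s k) with (vadd (vsub (s k) c) c) by vec_ring.
    eapply Rle_trans; [apply norm_triangle|]. specialize (H k). lra. }
  destruct (vec_subseq _ z _ (Hbd _ _ _ Hzb)) as [zs [phi [Hphi Hzs]]].
  destruct (vec_subseq _ (fun n => x (phi n)) _ (fun n => Hbd _ _ _ Hxb (phi n)))
    as [xs [psi [Hpsi Hxs]]].
  set (th := fun n => phi (psi n)).
  assert (Hth : forall n, (n <= th n)%nat).
  { intros n. unfold th. specialize (Hphi (psi n)). specialize (Hpsi n). lia. }
  assert (Hzth : conv (fun n => z (th n)) zs) by apply (conv_subseq _ _ _ psi Hpsi Hzs).
  assert (Hvth : conv (fun n => v (S (th n))) xs).
  { replace xs with (vadd xs vzero) by vec_ring.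
    replace (fun n => v (S (th n))) with (fun n => vadd (x (th n)) (r (th n)))
      by (extensionality n; unfold r; vec_ring).
    apply conv_add; [exact Hxs|]. now apply conv_subseq. }
  assert (Hfix : dr_step gamma f g zs xs xs).
  { split.
    - apply (subdiff_closed _ g (fun n => x (th n))
        (fun n => vscal (/ gamma) (vsub (z (th n)) (x (th n))))); [auto|exact Hxs| |].
      + now apply conv_scal, conv_sub.
      + intros n. apply Hstep.
    - apply (subdiff_closed _ f (fun n => v (S (th n)))
        (fun n => vscal (/ gamma) (vsub (vsub (vscal 2 (x (th n))) (z (th n))) (v (S (th n))))));
        [auto|exact Hvth| |].
      + apply conv_scal, conv_sub; [|auto]. apply conv_sub; [|auto]. now apply conv_scal.
      + intros n. apply Hstep. }
  (* Distances to [zs] do not increase, so one close iterate keeps all later ones close. *)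
  assert (Hcz : conv z zs).
  { intros e He. destruct (Hzth e He) as [n Hn]. exists (th n). intros k Hk.
    eapply Rle_lt_trans; [|apply (Hn n (le_n n))].
    replace k with ((k - th n) + th n)%nat by lia. eapply Hmono; eauto. }
  assert (Hcx : conv x xs).
  { intros e He. destruct (Hcz e He) as [K HK]. exists K. intros k Hk.
    eapply Rle_lt_trans; [|apply (HK k Hk)].
    eapply resolvent_nonexpansive; [exact Hg|apply Hstep|apply Hfix]. }
  exists zs, xs. split; [auto|]. split; [auto|]. split; [auto|].
  replace xs with (vadd xs vzero) by vec_ring.
  replace (fun k => v (S k)) with (fun k => vadd (x k) (r k))
    by (extensionality k; unfold r; vec_ring).
  now apply conv_add.
Qed.

Theorem theorem5p2 (N : nat) (f g : vec N -> ext) (gamma : R) (tau : nat -> R)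
  (z x v : nat -> vec N) :
  proper f -> lsc f -> convex f ->
  proper g -> lsc g -> convex g ->
  (exists y, ri (dom f) y /\ ri (dom g) y) ->
  (exists y, argmin_sum f g y) ->
  0 < gamma ->
  (forall k, 0 < tau k < 2) ->
  cv_infty (fun n => sum_f_R0 (fun k => tau k * (2 - tau k)) n) ->
  is_prox gamma g (z 0%nat) (x 0%nat) ->
  (forall k, is_prox gamma f (vsub (vscal 2 (x k)) (z k)) (v (S k))) ->
  (forall k, z (S k) = vadd (z k) (vscal (tau k) (vsub (v (S k)) (x k)))) ->
  (forall k, is_prox gamma g (z (S k)) (x (S k))) ->
  exists zs xs : vec N,
    conv z zs /\ is_prox gamma g zs xs /\ argmin_sum f g xs /\
    conv x xs /\ conv v xs /\
    let us := vscal (/ gamma) (vsub zs xs) in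
    (forall Sg Sgs, mirror_strat g Sg Sgs ->
       exists K, forall k, (K <= k)%nat ->
         forall M1 M2 M3, stratum Sg xs M1 -> stratum Sg (x k) M2 ->
           stratum Sgs us M3 ->
           strat_le M1 M2 /\ strat_le M2 (J (conjf g) M3)) /\
    (forall Sf Sfs, mirror_strat f Sf Sfs ->
       exists K, forall k, (K <= k)%nat ->
         forall M1 M2 M3, stratum Sf xs M1 -> stratum Sf (v k) M2 ->
           stratum Sfs (vopp us) M3 ->
           strat_le M1 M2 /\ strat_le M2 (J (conjf f) M3)).
Proof.
  intros _ Hlf Hcf _ Hlg Hcg Hri [xb Hxb] Hg Ht Hinf Hx0 Hv Hz Hx.
  assert (Hstep : forall k, dr_step gamma f g (z k) (x k) (v (S k))).
  { intros k. split; apply prox_subdiff; auto. destruct k; auto. }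
  (* At a fixed point the subgradients of [f] and [g] are opposite. *)
  assert (Hdual : forall zf xf, vscal (/ gamma) (vsub (vsub (vscal 2 xf) zf) xf)
                    = vopp (vscal (/ gamma) (@vsub N zf xf))) by (intros; vec_ring).
  destruct (argmin_sum_subdiff _ f g xb Hcf Hcg Hri Hxb) as [u [Hug Huf]].
  (* The splitting subgradient [u] yields the fixed point $x_b+\gamma u$. *)
  destruct (dr_convergence N gamma f g tau z x v (vadd xb (vscal gamma u)) xb)
    as [zs [xs [[Hfg Hff] [Hcz [Hcx Hcv]]]]]; auto.
  { assert (Hu : vscal (/ gamma) (vsub (vadd xb (vscal gamma u)) xb) = u)
      by (extensionality i; unfold vscal, vsub, vadd; field; lra).
    split; [|rewrite Hdual]; now rewrite Hu. }
  exists zs, xs. split; [auto|]. split; [now apply subdiff_prox|].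
  split. { eapply subdiff_argmin_sum; [exact Hfg|]. now rewrite <- Hdual. }
  split; [auto|]. split; [now apply conv_unshift|].
  intros us. split.
  - intros Sg Sgs Hms.
    apply (mirror_strat_identification _ g Sg Sgs x (fun k => vscal (/ gamma) (vsub (z k) (x k))));
      [auto|auto| |intros k; apply Hstep].
    now apply conv_scal, conv_sub.
  - intros Sf Sfs Hms.
    (* The subgradients of [f] at $v_{k+1}$ are $(2x_k-z_k-v_{k+1})/\gamma$, with limit
       $-u^\star$. *)
    destruct (mirror_strat_identification _ f Sf Sfs (fun k => v (S k))
      (fun k => vscal (/ gamma) (vsub (vsub (vscal 2 (x k)) (z k)) (v (S k)))) xs (vopp us))
      as [K HK]; [auto|auto| |intros k; apply Hstep|].
    + unfold us. rewrite <- Hdual. apply conv_scal, conv_sub; [|auto].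
      apply conv_sub; [|auto]. now apply conv_scal.
    (* The shift by one undoes the indexing of [v] and excludes the arbitrary [v O]. *)
    + exists (S K). intros [|k] Hk; [lia|]. apply HK. lia.
Qed.
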